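(* For $n\ge0$ let $U(n)$ be the number of uniquely realizable net-degree sequences of simple digraphs on $n$ labelled vertices. Then for all $n\ge 0$ \[ U(n)=\frac{n!}{\sqrt3}\Bigl((\sqrt3-1)^{-n-1}-(-\sqrt3-1)^{-n-1}\Bigr), \] and the exponential generating function is \[ \sum_{n\ge0}\frac{U(n)x^n}{n!}=\frac{1}{1-x-\frac{x^2}{2}} . \]
   Context: A (simple) digraph $D=(V,A)$ is a finite simple undirected graph together with an orientation of each edge; so $A\subseteq V\times V$ contains no $(v,v)$, and at most one of $(u,v),(v,u)$. Its net-degree sequence is $\mathbf d(D)\in\mathbb Z^V$ with $\mathbf d(D)_v=|\{u:(u,v)\in A\}|-|\{u:(v,u)\in A\}|$. A vector $\mathbf d\in\mathbb Z^n$ is a uniquely realizable net-degree sequence if there is exactly one simple digraph $D$ on the labelled node set $\{1,\dots,n\}$ with $\mathbf d(D)=\mathbf d$. *)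

(* Defs.v *)
From HB Require Import structures.
From mathcomp Require Import all_boot all_order all_algebra finmap.
From mathcomp Require Import boolp classical_sets functions cardinality reals.

Set Implicit Arguments.
Unset Strict Implicit.
Unset Printing Implicit Defensive.

Import Order.TTheory GRing.Theory Num.Theory.
Local Open Scope ring_scope.

(* A digraph on V is given by its set of arcs; (u, v) is the arc u -> v.      *)
Definition simple_digraph (V : finType) (A : {set V * V}) : bool :=
  [forall v, (v, v) \notin A] &&
  [forall u, forall v, ~~ (((u, v) \in A) && ((v, u) \in A))].

(* In-degree minus out-degree. *)
Definition net_degree (V : finType) (A : {set V * V}) : {ffun V -> int} :=
  [ffun v => #|[set u | (u, v) \in A]|%:Z - #|[set u | (v, u) \in A]|%:Z].

Definition uniquely_realizable (V : finType) (d : {ffun V -> int}) : Prop :=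
  exists! A : {set V * V}, simple_digraph A /\ net_degree A = d.

Definition uniquely_realizable_set (n : nat) : set {ffun 'I_n -> int} :=
  [set d | uniquely_realizable d]%classic.
Arguments uniquely_realizable_set n : clear implicits.

(* [fset_set] is only meaningful on finite sets. *)
Lemma finite_uniquely_realizable_set n : finite_set (uniquely_realizable_set n).
Proof.
apply: (@sub_finite_set _ _
  (@net_degree 'I_n @` [set: {set 'I_n * 'I_n}])%classic).
  by move=> d [A [[_ <-] _]]; exists A.
exact/finite_image/finite_finset.
Qed.

Definition U (n : nat) : nat := #|` fset_set (uniquely_realizable_set n)|%fset.

(******************************************************************************)
(* Formal power series in one variable, with the Cauchy product; a series     *)
(* over a field is a unit iff its constant coefficient is nonzero.            *)
(******************************************************************************)
Record fps (R : Type) := Fps { fps_coef : nat -> R }.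

HB.instance Definition _ (R : Type) := gen_eqMixin (fps R).
HB.instance Definition _ (R : Type) := gen_choiceMixin (fps R).

Lemma fpsP (R : Type) (f g : fps R) : fps_coef f =1 fps_coef g -> f = g.
Proof. by case: f g => [f] [g] /= /funext ->. Qed.

Section FpsRing.
Variable R : comNzRingType.
Implicit Types f g h : fps R.

Definition fps_zero : fps R := Fps (fun=> 0).
Definition fps_opp f : fps R := Fps (fun n => - fps_coef f n).
Definition fps_add f g : fps R := Fps (fun n => fps_coef f n + fps_coef g n).
Definition fps_one : fps R := Fps (fun n => (n == 0)%:R).
Definition fps_mul f g : fps R :=
  Fps (fun n => \sum_(i < n.+1) fps_coef f i * fps_coef g (n - i)).

Fact fps_addA : associative fps_add.
Proof. by move=> f g h; apply: fpsP => n /=; rewrite addrA. Qed.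
Fact fps_addC : commutative fps_add.
Proof. by move=> f g; apply: fpsP => n /=; rewrite addrC. Qed.
Fact fps_add0 : left_id fps_zero fps_add.
Proof. by move=> f; apply: fpsP => n /=; rewrite add0r. Qed.
Fact fps_addN : left_inverse fps_zero fps_opp fps_add.
Proof. by move=> f; apply: fpsP => n /=; rewrite addNr. Qed.

HB.instance Definition _ :=
  GRing.isZmodule.Build (fps R) fps_addA fps_addC fps_add0 fps_addN.

Definition fps_trunc n f : {poly R} := \poly_(i < n) fps_coef f i.

Lemma fps_mul_trunc n k f g : (k < n)%N ->
  fps_coef (fps_mul f g) k = (fps_trunc n f * fps_trunc n g)`_k.
Proof.
move=> kn; rewrite coefM /=; apply: eq_bigr => i _.
have ik : (i < n)%N by apply: leq_ltn_trans kn; rewrite -ltnS.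
by rewrite !coef_poly ik (leq_ltn_trans (leq_subr _ _) kn).
Qed.

Fact fps_mulA : associative fps_mul.
Proof.
move=> f g h; apply: fpsP => n.
transitivity (fps_trunc n.+1 f * (fps_trunc n.+1 g * fps_trunc n.+1 h))`_n.
  rewrite coefM [LHS]/=; apply: eq_bigr => i _.
  rewrite -(@fps_mul_trunc n.+1) ?ltnS ?leq_subr //.
  by rewrite coef_poly ltn_ord.
rewrite mulrA coefM [RHS]/=; apply: eq_bigr => i _.
rewrite -(@fps_mul_trunc n.+1) ?ltn_ord //.
by rewrite coef_poly ltnS leq_subr.
Qed.

Fact fps_mulC : commutative fps_mul.
Proof.
by move=> f g; apply: fpsP => n; rewrite !(@fps_mul_trunc n.+1) // mulrC.
Qed.

Fact fps_mul1 : left_id fps_one fps_mul.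
Proof.
move=> f; apply: fpsP => n /=; rewrite big_ord_recl /= mul1r subn0.
by rewrite big1 ?addr0 // => i _; rewrite mul0r.
Qed.

Fact fps_mulDl : left_distributive fps_mul fps_add.
Proof.
move=> f g h; apply: fpsP => n /=; rewrite -big_split /=.
by apply: eq_bigr => i _; rewrite mulrDl.
Qed.

Fact fps_one_neq0 : fps_one != 0.
Proof.
apply/eqP => /(congr1 (fun f => fps_coef f 0)) /= /eqP.
by rewrite oner_eq0.
Qed.

HB.instance Definition _ := GRing.Zmodule_isComNzRing.Build (fps R)
  fps_mulA fps_mulC fps_mul1 fps_mulDl fps_one_neq0.

Definition fpsX : fps R := Fps (fun n => (n == 1)%:R).

End FpsRing.

Section FpsUnitRing.
Variable F : fieldType.
Implicit Types f g : fps F.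

Definition fps_unit : {pred fps F} := [pred f | fps_coef f 0 != 0].

(* The coefficients of f^-1 of index n, n - 1, ..., 0, in this order. *)
Fixpoint fps_inv_rev f n : seq F :=
  if n is m.+1 then
    let s := fps_inv_rev f m in
    (- (fps_coef f 0)^-1 * \sum_(i < m.+1) fps_coef f i.+1 * s`_i) :: s
  else [:: (fps_coef f 0)^-1].

Definition fps_inv f : fps F :=
  if f \in fps_unit then Fps (fun n => (fps_inv_rev f n)`_0) else f.

Lemma nth_fps_inv_rev f n i : (i <= n)%N ->
  (fps_inv_rev f n)`_i = (fps_inv_rev f (n - i))`_0.
Proof. by elim: n i => [|n IHn] [|i] //= /IHn ->; rewrite subSS. Qed.

Fact fps_mulV : {in fps_unit, left_inverse 1 fps_inv *%R}.
Proof.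
move=> f fU; rewrite mulrC /fps_inv fU; move: fU; rewrite inE => f0.
apply: fpsP => -[|n]; rewrite [LHS]/= big_ord_recl /=.
  by rewrite big_ord0 addr0 divff.
rewrite mulrA mulrN divff // mulN1r; apply/eqP; rewrite addrC subr_eq0.
apply/eqP/eq_bigr => i _; rewrite /bump /= add1n subSS.
by rewrite -nth_fps_inv_rev // -ltnS.
Qed.

Fact fps_unitPl f g : g * f = 1 -> fps_unit f.
Proof.
move=> /(congr1 (fun f => fps_coef f 0)) /=; rewrite big_ord1 subn0 => gf.
by apply/eqP => f0; move/eqP: gf; rewrite f0 mulr0 eq_sym oner_eq0.
Qed.

Fact fps_inv_out : {in [predC fps_unit], fps_inv =1 id}.
Proof. by move=> f; rewrite inE /= /fps_inv => /negbTE ->. Qed.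

HB.instance Definition _ := GRing.ComNzRing_hasMulInverse.Build (fps F)
  fps_mulV fps_unitPl fps_inv_out.

End FpsUnitRing.

Definition egf (F : fieldType) (a : nat -> F) : fps F :=
  Fps (fun n => a n / n`!%:R).

(* Main.v *)
(* Call a pair u <> v a non-arc when (u, v) is not in A. Pushing one unit around
   a triangle of non-arcs preserves net degrees, so a uniquely realizable A has
   no such triangle. Conversely, the difference of A and another realization is
   a circulation supported on non-arcs of A. Among the vertices meeting it, take
   a with the fewest non-arcs and follow it along a, b, c: minimality makes
   (c, a) a non-arc, which closes a triangle.

   The same minimality argument shows that a triangle-free A has a unique top
   block: one vertex, or two nonadjacent ones, dominating all the others.
   Removing it gives u(n+2) = (n+2) u(n+1) + C(n+2, 2) u(n) for the number u(n)
   of such A on n vertices. So u(n) / n! satisfies the linear recurrence with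
   characteristic roots (1 +- sqrt 3) / 2, which are the inverses of sqrt 3 - 1
   and - sqrt 3 - 1. *)
Require Import Defs.
From HB Require Import structures.
From mathcomp Require Import all_boot all_order all_algebra finmap.
From mathcomp Require Import boolp classical_sets functions cardinality reals.
From mathcomp Require Import ring lra.

Set Implicit Arguments.
Unset Strict Implicit.
Unset Printing Implicit Defensive.

Import Order.TTheory GRing.Theory Num.Theory.
Local Open Scope ring_scope.

(** * Signed adjacency and triangles of non-arcs *)

Section Layered.
Variable V : finType.
Implicit Types (A T : {set V * V}) (B S : {set V}) (u v w : V).

Lemma simple_digraphP A :
  reflect ((forall v, (v, v) \notin A) /\
           (forall u v, (u, v) \in A -> (v, u) \notin A))
          (simple_digraph A).
Proof.
apply: (iffP andP) => -[irr asym]; split.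
- exact/forallP.
- move=> u v uv; have /forallP/(_ v) := forallP asym u.
  by rewrite uv.
- exact/forallP.
- apply/forallP => u; apply/forallP => v; apply/negP => /andP[uv vu].
  by move: (asym _ _ uv); rewrite vu.
Qed.

(** The skew-symmetric adjacency matrix of a digraph. Net degrees are its column sums, so two
    realizations can be subtracted entrywise. *)
Definition arc_sign A u v : int := ((u, v) \in A)%:R - ((v, u) \in A)%:R.

Lemma net_degreeE A v : net_degree A v = \sum_u arc_sign A u v.
Proof.
have card_sum (P : pred V) : #|[set u | P u]|%:Z = \sum_u (P u)%:R.
  rewrite -sum1_card -[LHS]natz natr_sum big_mkcond /=.
  by apply: eq_bigr => u _; rewrite inE; case: (P u).
by rewrite ffunE !card_sum -sumrB.
Qed.

Lemma arc_signN A u v : arc_sign A v u = - arc_sign A u v.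
Proof. by rewrite opprB. Qed.

Lemma mem_arc_sign A u v : simple_digraph A ->
  ((u, v) \in A) = (arc_sign A u v == 1).
Proof.
move=> /simple_digraphP[_ /(_ u v)]; rewrite /arc_sign.
by case: (_ \in _) => [/(_ isT)/negbTE-> //|_]; case: (_ \in _).
Qed.

Lemma arc_sign_inj A A' : simple_digraph A -> simple_digraph A' ->
  arc_sign A =2 arc_sign A' -> A = A'.
Proof.
move=> sA sA' eqA; apply/setP => -[u v].
by rewrite !mem_arc_sign // eqA.
Qed.

(** Covers both a nonadjacent pair and a pair joined by the reverse arc; these are the positions
    whose sign can still be raised. *)
Definition nonarc A u v := (u != v) && ((u, v) \notin A).

Definition triangle_free S A := [forall u in S, forall v in S, forall w in S,
  ~~ [&& nonarc A u v, nonarc A v w & nonarc A w u]].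

Lemma triangle_freeP S A :
  reflect {in S & &, forall u v w,
             nonarc A u v -> nonarc A v w -> ~~ nonarc A w u}
          (triangle_free S A).
Proof.
apply: (iffP idP) => [tf u v w uS vS wS uv vw | tf].
  have /'forall_in_'forall_in_forall_inP := tf.
  by move=> /(_ u uS v vS w wS); rewrite uv vw.
apply/'forall_in_'forall_in_forall_inP => u uS v vS w wS.
by apply/negP => /and3P[uv vw wu]; move: (tf u v w uS vS wS uv vw); rewrite wu.
Qed.

(** * Triangle-free digraphs are determined by their net degrees *)

Definition nonarc_set S A u := [set v in S | nonarc A u v].

(* If [w] dominated [v], any [z] not dominated by [w] would dominate [v], lest
   [v], [w], [z] be a triangle; so [v] would have more non-arcs than [w]. *)
Lemma nonarc_sym_of_min S A v w : simple_digraph A -> triangle_free S A ->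
  v \in S -> w \in S -> nonarc A v w ->
  (#|nonarc_set S A v| <= #|nonarc_set S A w|)%N -> nonarc A w v.
Proof.
move=> /simple_digraphP[_ asymA] /triangle_freeP tf vS wS vw.
apply: contraTT => nwv; rewrite -ltnNge; apply/proper_card/properP; split.
  apply/fintype.subsetP => z; rewrite !inE => /andP[zS wz]; rewrite zS /=.
  have := tf v w z vS wS zS vw wz; rewrite /nonarc negb_and !negbK.
  case/orP => [/eqP zv | /asymA vz].
    by move: nwv; rewrite -zv wz.
  by rewrite vz andbT; apply: contraNneq nwv => ->.
by exists w; rewrite !inE ?wS ?vw // /nonarc eqxx andbF.
Qed.

Lemma net_degree_inj_triangle_free A A' :
  simple_digraph A -> triangle_free [set: V] A -> simple_digraph A' ->
  net_degree A = net_degree A' -> A = A'.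
Proof.
move=> sA tfA sA' eqd; apply: arc_sign_inj => //.
(* The circulation carrying [A] to [A']: skew-symmetric, with all row and column sums zero. *)
pose y u v := arc_sign A' u v - arc_sign A u v.
have yN u v : y v u = - y u v by rewrite /y !(arc_signN _ u v); ring.
have ysum v : \sum_u y u v = 0 by rewrite sumrB -!net_degreeE eqd subrr.
have ysum' u : \sum_v y u v = 0.
  by under eq_bigr do rewrite yN; rewrite sumrN ysum oppr0.
(* On an arc of [A] the sign is already the maximal value 1, so it cannot increase. *)
have y_nonarc u v : 0 < y u v -> nonarc A u v.
  move=> yuv; apply/andP; split.
    by apply: contraTneq yuv => ->; rewrite /y /arc_sign !subrr.
  move/simple_digraphP: sA => [_ asymA].
  apply: contraTN yuv => uv; rewrite /y /arc_sign uv (negbTE (asymA _ _ uv)).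
  by do 2! [case: (_ \in A')].
(* A row of sum zero with a nonzero entry must have a positive one, so the vertices meeting the
   circulation are those with positive outflow. *)
have y_out u v : y u v != 0 -> exists w, 0 < y u w.
  move=> yuv; apply/existsP; apply: contraNT yuv => /existsPn ny.
  have y0 w : y u w <= 0 by rewrite leNgt.
  have /eqP := ysum' u; rewrite -oppr_eq0 -sumrN.
  rewrite psumr_eq0 => [/allP/(_ v (mem_index_enum _))|w _].
    by rewrite oppr_eq0.
  by rewrite oppr_ge0.
suff y0 u v : y u v = 0 by move=> u v; apply/esym/subr0_eq/y0.
apply/eqP; apply: contraT => /y_out Pu.
pose P u := [exists w, 0 < y u w].
have Pu0 : P u by apply/existsP.
case: (arg_minnP (fun u => #|nonarc_set [set: V] A u|) Pu0)
  => {u Pu Pu0} a Pa a_min.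
have P_in b c : 0 < y b c -> P c.
  by move=> bc; apply/existsP/(y_out c b); rewrite yN oppr_eq0 gt_eqF.
have back b c : 0 < y b c -> nonarc A a c -> nonarc A c a.
  move=> /P_in Pc ac.
  by apply: (nonarc_sym_of_min sA tfA _ _ ac (a_min _ Pc));
    apply: finset.in_setT.
have /existsP[b ab] := Pa; have /existsP[c bc] := P_in _ _ ab.
have inT x : x \in [set: V]%SET by apply: finset.in_setT.
(* Triangle-freeness makes [(c, a)] an arc, hence [(a, c)] a non-arc; by minimality of [a], [back]
   then makes [(c, a)] a non-arc, a contradiction. *)
have bca := triangle_freeP _ _ tfA a b c (inT _) (inT _) (inT _)
  (y_nonarc _ _ ab) (y_nonarc _ _ bc).
have ca : c != a.
  by apply: contraTneq bc => ->; rewrite yN oppr_gt0 -leNgt ltW.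
case/negP: (bca); apply: (back _ _ bc); rewrite /nonarc eq_sym ca /=.
move: bca; rewrite /nonarc ca negbK /= => ca_arc.
by have /simple_digraphP[_ /(_ _ _ ca_arc)] := sA.
Qed.

(** * Unique realizations are triangle-free *)

(* Pushing one unit along each arc of [T] cancels the opposite arcs of [A]. *)
Definition push T A := [set p | (p \in A) && ((p.2, p.1) \notin T)
                             || (p \in T) && ((p.2, p.1) \notin A)].

(** Disjointness keeps the sum of signs within -1, 0, 1: an arc common to [T] and [A] would give
    2. *)
Lemma arc_sign_push T A u v : simple_digraph T -> simple_digraph A ->
  [disjoint T & A] ->
  arc_sign (push T A) u v = arc_sign T u v + arc_sign A u v.
Proof.
move=> /simple_digraphP[_ asymT] /simple_digraphP[_ asymA] dTA.
rewrite /arc_sign !inE /=.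
have := disjointFr dTA (x := (u, v)); have := disjointFr dTA (x := (v, u)).
move: (asymT u v) (asymA u v).
case: ((u, v) \in T) => /=; case: ((v, u) \in T) => //=;
case: ((u, v) \in A) => //=; case: ((v, u) \in A) => //= h1 h2 h3 h4;
by [move: (h1 isT) | move: (h2 isT) | move: (h3 isT) | move: (h4 isT)].
Qed.

Lemma simple_push T A : simple_digraph T -> simple_digraph A ->
  [disjoint T & A] -> simple_digraph (push T A).
Proof.
move=> /simple_digraphP[irrT asymT] /simple_digraphP[irrA asymA] dTA.
apply/simple_digraphP; split=> [v|u v].
  by rewrite inE /= (negbTE (irrT v)) (negbTE (irrA v)).
rewrite !inE /=.
have := disjointFr dTA (x := (u, v)); have := disjointFr dTA (x := (v, u)).
move: (asymT u v) (asymA u v).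
case: ((u, v) \in T) => /=; case: ((v, u) \in T) => //=;
case: ((u, v) \in A) => //=; case: ((v, u) \in A) => //= h1 h2 h3 h4;
by [move: (h1 isT) | move: (h2 isT) | move: (h3 isT) | move: (h4 isT)].
Qed.

Lemma triangle_free_of_unique A : simple_digraph A ->
  (forall A', simple_digraph A' -> net_degree A' = net_degree A -> A' = A) ->
  triangle_free [set: V] A.
Proof.
move=> sA uniqA; apply/triangle_freeP => u v w _ _ _ uv vw; apply/negP => wu.
pose T : {set V * V} := [set (u, v); (v, w); (w, u)].
have [/andP[neuv uvA] /andP[nevw vwA] /andP[newu wuA]] := And3 uv vw wu.
(* The three arcs are distinct, so membership in [T] is a sum of indicators, which can be summed
   over one coordinate. *)
have inT a b : ((a, b) \in T)%:R =
   ((a == u) && (b == v))%:R + ((a == v) && (b == w))%:R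
     + ((a == w) && (b == u))%:R :> int.
  rewrite !inE !xpair_eqE.
  case: (eqVneq a u) => [->|_] /=.
    by rewrite (negbTE neuv) [u == w]eq_sym (negbTE newu); case: (b == v).
  case: (eqVneq a v) => [->|_] /=.
    by rewrite (negbTE nevw); case: (b == w).
  by case: (_ && _).
have sT : simple_digraph T.
  apply/simple_digraphP; split=> [a|a b]; rewrite !inE !xpair_eqE.
    by apply/negP => /orP[/orP[]|] /andP[/eqP->]; apply/negP.
  have ne := (negbTE neuv, negbTE nevw, negbTE newu).
  have ne' := (eq_sym v u, eq_sym w v, eq_sym u w).
  by case/orP => [/orP[]|] /andP[/eqP-> /eqP->]; rewrite ?eqxx ?ne' !ne.
have dTA : [disjoint T & A].
  apply/pred0P => -[a b] /=; rewrite !inE !xpair_eqE.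
  by apply/negP => /andP[/orP[/orP[]|] /andP[/eqP-> /eqP->]]; apply/negP.
have dT0 x : net_degree T x = 0.
  have sum_delta a b : \sum_z ((z == a) && (x == b))%:R = (x == b)%:R :> int.
    by rewrite (bigD1 a) //= eqxx /= big1 ?addr0 // => z /negbTE->.
  have sum_delta' a b : \sum_z ((x == a) && (z == b))%:R = (x == a)%:R :> int.
    by under eq_bigr do rewrite andbC; exact: sum_delta.
  rewrite net_degreeE /arc_sign sumrB.
  under eq_bigr do rewrite inT.
  under [X in _ - X]eq_bigr do rewrite inT.
  by rewrite !big_split /= !sum_delta !sum_delta'; ring.
have dpush : net_degree (push T A) = net_degree A.
  apply/ffunP => x; rewrite !net_degreeE.
  under eq_bigr do rewrite arc_sign_push //.
  by rewrite big_split /= -net_degreeE dT0 add0r.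
(* Uniqueness forces the pushed digraph to equal [A], although its sign at [(u, v)] has grown by
   1. *)
have /(congr1 (fun A' => arc_sign A' u v)) :=
  uniqA _ (simple_push sT sA dTA) dpush.
rewrite arc_sign_push //; rewrite {1}/arc_sign.
have uvT : (u, v) \in T by rewrite !inE eqxx.
have /simple_digraphP[_ /(_ _ _ uvT) /negbTE->] := sT.
by rewrite uvT subr0; move/eqP; rewrite -subr_eq0 addrK.
Qed.

(** * Decomposition along the top block *)

(** Digraphs on [S] are kept as arc sets over the whole of [V], so that deleting vertices does not
    change the type. *)
Definition layered S := [set A : {set V * V} |
  [&& simple_digraph A, A \subset finset.setX S S & triangle_free S A]].

Definition top_block S A B :=
  [forall u in B, forall v in B, (u, v) \notin A] &&
  [forall u in B, forall v in S :\: B, (u, v) \in A].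

Lemma top_blockP S A B :
  reflect ({in B &, forall u v, (u, v) \notin A} /\
           {in B & S :\: B, forall u v, (u, v) \in A})
          (top_block S A B).
Proof.
apply: (iffP andP) => -[h1 h2]; split.
- by move=> u v uB vB; have /'forall_in_forall_inP := h1; apply.
- by move=> u v uB vB; have /'forall_in_forall_inP := h2; apply.
- by apply/'forall_in_forall_inP => u uB v vB; exact: h1.
- by apply/'forall_in_forall_inP => u uB v vB; exact: h2.
Qed.

Definition block S B := (B \subset S) && (0 < #|B| <= 2)%N.

(** Let [v] have the fewest non-arcs. By [nonarc_sym_of_min] each of its non-arcs is mutual; the
    block is [v] alone if there is none, and otherwise [v] with one nonadjacent vertex [w]. *)
Lemma top_block_exists S A : S != finset.set0 -> A \in layered S ->
  exists2 B, block S B & top_block S A B.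
Proof.
case/set0Pn => s0 s0S; rewrite inE => /and3P[sA _ tfA].
have [irrA asymA] := simple_digraphP _ sA.
case: (arg_minnP (fun u => #|nonarc_set S A u|) s0S) => {s0 s0S} v vS v_min.
have back w : w \in nonarc_set S A v -> nonarc A w v.
  rewrite inE => /andP[wS vw].
  exact: nonarc_sym_of_min sA tfA vS wS vw (v_min _ wS).
have [N0 | [w wN]] := set_0Vmem (nonarc_set S A v).
  exists [set v]; first by rewrite /block finset.sub1set cards1 andbT.
  apply/top_blockP; split=> [a b /set1P-> /set1P-> //|a b /set1P-> ].
  rewrite !inE => /andP[bv bS]; apply: contraT => vb.
  by have := finset.in_set0 b; rewrite -N0 inE bS /nonarc eq_sym bv vb.
have := wN; rewrite inE => /andP[wS vw].
have wv := back _ wN.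
have [nevw vwA] := andP vw; have [_ wvA] := andP wv.
(* If [v] did not dominate [b], they would be nonadjacent, and the paths [b], [v], [w] and [w], [v],
   [b] of non-arcs would force arcs both ways between [w] and [b]. *)
have dom_v b : b \in S -> b != v -> b != w -> (v, b) \in A.
  move=> bS bv bw; apply: contraT => vbA.
  have vb : nonarc A v b by rewrite /nonarc eq_sym bv.
  have bv' : nonarc A b v by apply: back; rewrite inE bS.
  have := triangle_freeP _ _ tfA b v w bS vS wS bv' vw.
  have := triangle_freeP _ _ tfA w v b wS vS bS wv vb.
  rewrite /nonarc [w == b]eq_sym bw /= !negbK.
  by move=> /asymA/negbTE->.
exists [set v; w].
  rewrite /block cards2 nevw andbT; apply/fintype.subsetP => x.
  by rewrite !inE => /orP[] /eqP->.
apply/top_blockP; split=> [a b|a b].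
  by rewrite !inE => /orP[] /eqP-> /orP[] /eqP->.
rewrite !inE negb_or => a_vw /andP[/andP[bv bw] bS].
have vb := dom_v _ bS bv bw; case/orP: a_vw => /eqP-> //.
apply: contraT => wbA.
have wb : nonarc A w b by rewrite /nonarc eq_sym bw.
have := triangle_freeP _ _ tfA v w b vS wS bS vw wb.
by rewrite /nonarc bv (negbTE (asymA _ _ vb)).
Qed.

(** A vertex [b] of [B] outside [B'] is dominated by some [b'] in [B']. If [b'] is outside [B], then
    [b] dominates it in return; if inside, [B] contains an arc. *)
Lemma top_block_uniq S A B B' : simple_digraph A -> block S B -> block S B' ->
  top_block S A B -> top_block S A B' -> B = B'.
Proof.
move=> /simple_digraphP[_ asymA].
suff sub C C' : block S C -> block S C' ->
    top_block S A C -> top_block S A C' -> C \subset C'.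
  by move=> *; apply/eqP; rewrite finset.eqEsubset !sub.
move: C C' => {}B {}B'.
move=> /andP[BS /andP[B0 _]] /andP[B'S /andP[B'0 _]].
move=> /top_blockP[indB domB] /top_blockP[indB' domB'].
apply/fintype.subsetP => b bB; apply: contraT => bB'.
have bSB' : b \in S :\: B' by rewrite !inE bB' (fintype.subsetP BS).
have [b' b'B'] := card_gt0P B'0.
have b'b := domB' _ _ b'B' bSB'.
have b'B : b' \in B.
  apply: contraT => b'B; have /negP[] := asymA _ _ b'b.
  by apply: domB => //; rewrite !inE b'B (fintype.subsetP B'S).
by have := indB _ _ b'B bB; rewrite b'b.
Qed.

Lemma card_le2_distinct B u v w : (#|B| <= 2)%N -> u \in B -> v \in B ->
  w \in B -> u != v -> v != w -> w != u -> False.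
Proof.
move=> B2 uB vB wB uv vw wu.
have: [set u; v; w] \subset B.
  by apply/fintype.subsetP => x; rewrite !inE => /orP[/orP[]|] /eqP->.
move/subset_leq_card/leq_trans/(_ B2).
by rewrite finset.setUC cardsU1 cards2 uv !inE negb_or wu eq_sym vw.
Qed.

(** The bijection adds all arcs from [B] to the rest of [S]; its inverse restricts to the arcs
    outside [B]. *)
Lemma card_layered_top_block S B : block S B ->
  #|[set A in layered S | top_block S A B]| = #|layered (S :\: B)|.
Proof.
case/andP=> BS /andP[_ B2].
pose f A := A :|: finset.setX B (S :\: B).
have inf A u v : ((u, v) \in f A) =
    ((u, v) \in A) || [&& u \in B, v \notin B & v \in S] by rewrite !inE.
have subP S' A : A \subset finset.setX S' S' ->
    forall u v, (u, v) \in A -> (u \in S') * (v \in S').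
  by move=> /fintype.subsetP sub u v /sub; rewrite inE /= => /andP[-> ->].
pose D := S :\: B.
have inD A : A \in layered D -> forall u v, (u, v) \in A ->
    [&& u \in S, u \notin B, v \in S & v \notin B].
  rewrite inE => /and3P[_ /subP sub _] u v /sub[].
  by rewrite !inE => /andP[-> ->] /andP[-> ->].
rewrite -[RHS](@card_in_imset _ _ f); last first.
  move=> A A' AD A'D /finset.setP eqf; apply/finset.setP => -[u v].
  have := eqf (u, v); rewrite !inf.
  case: (boolP (u \in B)) => uB; last by rewrite !orbF.
  move=> _; apply/idP/idP.
    by move/(inD _ AD); rewrite uB andbF.
  by move/(inD _ A'D); rewrite uB andbF.
congr #|pred_of_set _|; apply/finset.setP => A; rewrite inE.
apply/andP/imsetP => [[] | [A' A'D ->{A}]].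
  rewrite inE.
  move=> /and3P[/simple_digraphP[irrA asymA] /subP sub /triangle_freeP tf].
  move=> /top_blockP[indB domB].
  exists (A :&: finset.setX D D); last first.
    apply/finset.setP => -[u v]; rewrite inf !inE /=.
    have [uB|uB] := boolP (u \in B); have [vB|vB] := boolP (v \in B) => /=;
      rewrite ?andbF ?orbF /=.
    - by rewrite (negbTE (indB _ _ uB vB)).
    - apply/idP/idP => [/sub[] // | vS].
      by apply: domB => //; rewrite !inE vB.
    - apply/negP => uv; have /negP[] := asymA _ _ uv; apply: domB => //.
      by rewrite !inE uB (sub _ _ uv).
    - by case: (boolP ((u, v) \in A)) => //= /sub[-> ->].
  rewrite inE; apply/and3P; split; last 2 first.
  - exact: finset.subsetIr.
  - apply/triangle_freeP => u v w; rewrite !inE.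
    move=> /andP[uB uS] /andP[vB vS] /andP[wB wS].
    rewrite /nonarc !inE /= uS uB vS vB wS wB !andbT.
    exact: tf.
  apply/simple_digraphP; split=> [u|u v].
    by rewrite inE (negbTE (irrA u)).
  by rewrite !inE /= => /andP[/asymA/negbTE->].
have inA' := inD _ A'D.
move: A'D; rewrite inE.
move=> /and3P[/simple_digraphP[irrA asymA] _ /triangle_freeP tf].
split; last first.
  apply/top_blockP; split=> u v uB.
    move=> vB; rewrite inf vB andbF orbF.
    by apply/negP => /inA'; rewrite uB andbF.
  by rewrite !inE uB => ->; rewrite orbT.
rewrite inE; apply/and3P; split.
- apply/simple_digraphP; split=> [u|u v]; rewrite !inf.
    by rewrite (negbTE (irrA u)); case: (u \in B).
  case/orP => [uv | /and3P[uB vB _]].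
    rewrite (negbTE (asymA _ _ uv)) /=.
    by case/inA'/and4P: uv => _ _ _ /negbTE->.
  rewrite (negbTE vB) orbF; apply/negP => /inA'.
  by rewrite uB !andbF.
- apply/fintype.subsetP => -[u v]; rewrite inf [in X in _ -> X]inE /=.
  case/orP => [/inA'/and4P[-> _ -> _] // | /and3P[uB _ ->]].
  by rewrite (fintype.subsetP BS).
apply/triangle_freeP => u v w uS vS wS uv vw; apply/negP => wu.
(* Non-arcs never leave [B], so a triangle of them lies wholly inside [B], which has at most two
   vertices, or wholly outside, where [A'] has none. *)
have stay a b : b \in S -> nonarc (f A') a b -> a \in B -> b \in B.
  move=> bS /andP[_]; rewrite inf bS negb_or => /andP[_] + aB.
  by rewrite aB andbT /= negbK.
have nonarc_f a b : nonarc (f A') a b -> nonarc A' a b.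
  by rewrite /nonarc inf negb_or => /and3P[-> ->].
have [uB | uB] := boolP (u \in B).
  have vB := stay _ _ vS uv uB; have wB := stay _ _ wS vw vB.
  have [/andP[neuv _] /andP[nevw _] /andP[newu _]] := And3 uv vw wu.
  exact: (card_le2_distinct B2 uB vB wB).
have wB : w \notin B by apply: contra uB; exact: stay.
have vB : v \notin B by apply: contra wB; exact: stay.
have := tf u v w; rewrite !inE uB uS vB vS wB wS.
move=> /(_ isT isT isT (nonarc_f _ _ uv) (nonarc_f _ _ vw)) /negP; apply.
exact: nonarc_f.
Qed.

Lemma card_layered_rec S : S != finset.set0 ->
  #|layered S| = (\sum_(B | block S B) #|layered (S :\: B)|)%N.
Proof.
move=> S0; rewrite -sum1_card.
under [RHS]eq_bigr => B bB do
  rewrite -(card_layered_top_block bB) -sum1_card big_mkcond /=.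
(* Double counting: each layered digraph contributes exactly 1, through its unique top block. *)
rewrite exchange_big /= big_mkcond /=; apply: eq_bigr => A _.
under eq_bigr do rewrite inE.
have [AS|AS] := boolP (A \in layered S); last by rewrite big1.
have [B bB tB] := top_block_exists S0 AS.
rewrite (bigD1 B) //= tB big1 // => B' /andP[bB' neB'].
case: ifP => // tB'; case/eqP: neB'; move: AS; rewrite inE => /and3P[sA _ _].
exact: top_block_uniq sA bB' bB tB' tB.
Qed.

(** * Enumeration by the number of vertices *)

(** The number of ordered set partitions of [n] points into blocks of size one or two, by choice of
    the first block. *)
Fixpoint layered_count n : nat :=
  if n is m.+1 then
    n * layered_count m + (if m is k.+1 then 'C(n, 2) * layered_count k else 0)
  else 1.

Lemma card_layered S : #|layered S| = layered_count #|S|.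
Proof.
have [n] := ubnP #|S|; elim: n S => // n IHn S; rewrite ltnS => Sn.
have [-> | S0] := eqVneq S finset.set0.
  rewrite cards0 /= (_ : layered _ = [set finset.set0]) ?cards1 //.
  apply/finset.setP => A; rewrite !inE; apply/and3P/eqP => [[_ + _] | ->].
    move=> /fintype.subsetP sub; apply/finset.setP => p; rewrite inE.
    by apply/negP => /sub; rewrite !inE.
  split; last by apply/triangle_freeP => u v w; rewrite inE.
    by apply/simple_digraphP; split=> *; rewrite inE // in_set0.
  exact: finset.sub0set.
(* At [m = 1] the subtraction [m - 2] truncates to 0, harmlessly since the binomial factor
   vanishes. *)
have countE m : (0 < m)%N -> layered_count m =
    (m * layered_count (m - 1) + 'C(m, 2) * layered_count (m - 2))%N.
  by case: m => [|[|m]] // _; rewrite !subSS !subn0.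
have S1 : (0 < #|S|)%N by rewrite card_gt0.
rewrite card_layered_rec // countE //.
have sum_k k : (0 < k)%N ->
    (\sum_(B : {set V} | (B \subset S) && (#|B| == k)) #|layered (S :\: B)|
       = 'C(#|S|, k) * layered_count (#|S| - k))%N.
  move=> k0; rewrite -cards_draws -sum1_card big_distrl /=.
  apply: eq_big => B; first by rewrite inE.
  move=> /andP[BS /eqP Bk]; rewrite mul1n.
  rewrite IHn cardsD (finset.setIidPr BS) Bk //.
  by apply: leq_trans Sn; rewrite ltn_subrL k0.
rewrite -[X in (X * _)%N](bin1 #|S|) -!sum_k // [RHS]addnC.
rewrite (bigID (fun B => #|B| == 2)) /=; congr (_ + _)%N.
  apply: eq_bigl => B; rewrite /block.
  by case: eqP => [->|]; rewrite ?andbT ?andbF.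
apply: eq_bigl => B; rewrite /block -andbA; congr (_ && _).
by case: #|B| => [|[|[|]]].
Qed.

End Layered.

(** Presents the set as the image of an explicit finite set; [net_degree] being injective there,
    cardinalities can be compared. *)
Lemma uniquely_realizable_layered n : uniquely_realizable_set n =
  [set` (@net_degree 'I_n @` [fset A in layered [set: 'I_n]])%fset]%classic.
Proof.
apply/seteqP; split=> d /=.
  move=> [A [[sA dA] uniqA]]; apply/imfsetP; exists A => //=.
  rewrite !inE; apply/and3P; split=> //.
    by apply/fintype.subsetP => p _; rewrite !inE.
  by apply: triangle_free_of_unique => // A' sA' dA'; rewrite (uniqA A') ?dA'.
case/imfsetP => A /=; rewrite !inE => /and3P[sA _ tfA] ->.
exists A; split=> // A' [sA' dA'].
exact: net_degree_inj_triangle_free.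
Qed.

Lemma U_layered_count n : U n = layered_count n.
Proof.
rewrite /U uniquely_realizable_layered set_fsetK card_in_imfset /=.
  by rewrite card_finset card_layered cardsT card_ord.
move=> A A'; rewrite !inE => /and3P[sA _ tfA] /and3P[sA' _ _].
exact: net_degree_inj_triangle_free.
Qed.

(** * Closed form and generating function *)

Lemma layered_count_div_fact (F : numFieldType) n :
  (layered_count n.+2)%:R / n.+2`!%:R =
  (layered_count n.+1)%:R / n.+1`!%:R + (layered_count n)%:R / n`!%:R / 2 :> F.
Proof.
have bin_n : 'C(n.+2, 2)%:R = n.+2%:R * n.+1%:R / 2 :> F.
  have /(congr1 (fun k => k%:R : F)) := mul_bin_diag n.+2 1.
  by rewrite bin1 !natrM => ->; field.
have -> : layered_count n.+2 =
  (n.+2 * layered_count n.+1 + 'C(n.+2, 2) * layered_count n)%N by [].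
rewrite !factS natrD !natrM bin_n; field.
by rewrite -(natrD F 1) -(natrD F 2) !pnatr_eq0 -lt0n fact_gt0.
Qed.

Lemma fps_coefMX (F : fieldType) (f : fps F) n :
  fps_coef (f * fpsX F) n = if n is m.+1 then fps_coef f m else 0.
Proof.
rewrite mulrC; case: n => [|n] /=; rewrite big_ord_recl mul0r ?add0r.
  by rewrite big_ord0.
rewrite big_ord_recl /= mul1r subSS subn0 big1 ?addr0 // => i _.
by rewrite mul0r.
Qed.

Theorem theorem3p7 (R : realType) :
  (forall n : nat,
     (U n)%:R = n`!%:R / Num.sqrt 3
       * ((Num.sqrt 3 - 1) ^- n.+1 - (- Num.sqrt 3 - 1) ^- n.+1) :> R)
  /\ egf (fun n : nat => (U n)%:R : R)
     = 1 / (1 - fpsX R - fpsX R ^+ 2 / 2) :> fps R.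
Proof.
have fact_neq0 k : k`!%:R != 0 :> R by rewrite pnatr_eq0 -lt0n fact_gt0.
pose a n : R := (layered_count n)%:R / n`!%:R.
have a0 : a 0 = 1 by rewrite /a divr1.
have a1 : a 1 = 1 by rewrite /a divr1.
have a_rec n : a n.+2 = a n.+1 + a n / 2 := layered_count_div_fact R n.
split.
  set s := Num.sqrt 3; have s2 : s ^+ 2 = 3 by rewrite sqr_sqrtr ?ler0n.
  have s_gt1 : 1 < s by rewrite -sqrtr1 ltr_sqrt ?ltr1n.
  (* Both inverses come from [s ^+ 2 = 3], which gives [(s - 1) * (s + 1) = 2]. *)
  have p_inv : (s - 1)^-1 = (s + 1) / 2.
    apply: (mulfI (_ : s - 1 != 0)); first by rewrite gt_eqF ?subr_gt0.
    rewrite divff; last by rewrite gt_eqF ?subr_gt0.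
    by rewrite mulrA -subr_sqr s2 expr1n; field.
  have q_inv : (- s - 1)^-1 = (1 - s) / 2.
    have q0 : - s - 1 != 0 by lra.
    apply: (mulfI q0); rewrite divff //.
    by rewrite (_ : _ * _ = (s ^+ 2 - 1) / 2);
        [rewrite s2; field | field].
  have closed n : a n = s^-1 * ((s - 1) ^- n.+1 - (- s - 1) ^- n.+1).
    rewrite -!exprVn p_inv q_inv; move: n.
    (* Two consecutive values are carried because the recurrence has order two. *)
    suff both n : a n = s^-1 * (((s + 1) / 2) ^+ n.+1 - ((1 - s) / 2) ^+ n.+1)
       /\ a n.+1 = s^-1 * (((s + 1) / 2) ^+ n.+2 - ((1 - s) / 2) ^+ n.+2).
      by move=> n; have [] := both n.
    have s0 : s != 0 by lra.
    elim: n => [|n [IH0 IH1]].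
      by rewrite a0 a1 !expr1 !expr2; split; field.
    split=> //; rewrite a_rec IH1 IH0.
    (* Powers of a root of the characteristic equation satisfy the recurrence of [a]. *)
    have step (x : R) k : x ^+ 2 = x + 2^-1 ->
        x ^+ k.+2 = x ^+ k.+1 + x ^+ k / 2.
      by move=> x2; rewrite -(addn2 k) exprD x2 mulrDr -exprSr.
    have root_p : ((s + 1) / 2) ^+ 2 = (s + 1) / 2 + 2^-1.
      by rewrite (_ : _ ^+ 2 = (s ^+ 2 + 2 * s + 1) / 4);
        [rewrite s2; field | field].
    have root_q : ((1 - s) / 2) ^+ 2 = (1 - s) / 2 + 2^-1.
      by rewrite (_ : _ ^+ 2 = (s ^+ 2 - 2 * s + 1) / 4);
        [rewrite s2; field | field].
    by rewrite (step _ n.+1 root_p) (step _ n.+1 root_q); ring.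
  move=> n; rewrite U_layered_count mulrAC -mulrA -[_ * s^-1]mulrC -closed.
  by rewrite mulrC divfK.
set Y := fpsX R ^+ 2 / 2; set D := 1 - fpsX R - Y.
have two_unit : (2 : fps R) \is a GRing.unit.
  have : fps_coef (2 : fps R) 0 != 0.
    by rewrite -[fps_coef _ _]/(2 : R) pnatr_eq0.
  exact.
(* Division by 2 in [Y] takes place in the ring of series; doubling turns it into division of
   coefficients. *)
have coefY (f : fps R) n :
    fps_coef (f * Y) n = fps_coef (f * fpsX R ^+ 2) n / 2.
  have /(congr1 (fun g => fps_coef g n)) : f * Y + f * Y = f * fpsX R ^+ 2.
    by rewrite -mulr2n -mulr_natr -mulrA divrK.
  by move=> /= <-; field.
have egfD : egf (fun n => (U n)%:R : R) * D = 1.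
  set f := egf _.
  have fE n : fps_coef f n = a n by rewrite /f /= U_layered_count.
  (* For [n] at least 2 the coefficient vanishes by [a_rec]; indices 0 and 1 use the initial
     values. *)
  apply: fpsP => n; rewrite !mulrBr mulr1.
  rewrite -[LHS]/(fps_coef f n - fps_coef (f * fpsX R) n - fps_coef (f * Y) n).
  rewrite coefY expr2 mulrA !fps_coefMX.
  case: n => [|[|n]]; rewrite ?fps_coefMX !fE /=.
  - by rewrite a0 mul0r !subr0.
  - by rewrite a0 a1 mul0r subr0 subrr.
  - by rewrite a_rec; field.
have D_unit : D \is a GRing.unit.
  by apply/unitrPr; exists (egf (fun n => (U n)%:R)); rewrite mulrC.
by rewrite -egfD mulrK.
Qed.
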